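(* For each $n$ let $d$ be a positive integer, let $\mathbf{x}=\{x_1,\ldots,x_n\}$ be points of the unit sphere $\mathbb{S}^{d-1}\subset\mathbb{R}^d$, and let $r\in[0,2]$, $p\in[0,1]$, $s\in[0,1]$ (all possibly depending on $n$). Let $(G_1,G_2)$ be a pair of correlated noisy random geometric graphs with parameters $(\mathbf{x},r,p)$, subsampling probability $s$, and latent permutation $\pi_*$. Suppose that $p\le n^{-\alpha+o(1)}$ for some constant $\alpha\in(1/2,1]$, and let $k>12/(2\alpha-1)$ be a constant positive integer. Furthermore, suppose that there exists a constant $\epsilon>0$ such that $$ps^2\min_{i\in[n]}\bigl|\{j\in[n]:\|x_i-x_j\|_2\le r\}\bigr|\ge(1+\epsilon)\log n .$$ Let $(\widehat M_k,\widehat\mu_k)$ be the $k$-core estimator of $(G_1,G_2)$. Then $\mathbb{P}(\widehat\mu_k=\pi_* )=1-o(1)$ as $n\to\infty$ (where $\widehat\mu_k=\pi_*$ means $\widehat M_k=[n]$ and $\widehat\mu_k(i)=\pi_*(i)$ for all $i$).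
   Context: Correlated noisy random geometric graphs with parameters $(\mathbf{x},r,p)$ and subsampling probability $s$: generate a simple undirected random graph $G$ on $[n]$ in which each edge $\{i,j\}$, $i\ne j$, is present with probability $p_{ij}=p\,\mathbf{1}(\|x_i-x_j\|_2\le r)$, independently over unordered pairs; conditionally on $G$, generate $G_1$ and $G_2'$ independently, each keeping every edge of $G$ independently with probability $s$ (same vertex set $[n]$); finally let $\pi_*$ be an independent uniformly random permutation of $[n]$ and let $G_2$ be $G_2'$ with vertices relabelled by $\pi_*$, so that $\{\pi_*(i),\pi_*(j)\}$ is an edge of $G_2$ iff $\{i,j\}$ is an edge of $G_2'$. A matching is a pair $(M,\mu)$ with $M\subseteq[n]$ and $\mu:M\to[n]$ injective. $G_1\wedge_\mu G_2$ is the graph on vertex set $M$ in which $\{i,j\}$ is an edge iff $\{i,j\}$ is an edge of $G_1$ and $\{\mu(i),\mu(j)\}$ is an edge of $G_2$. A matching is a $k$-core matching if every vertex of $G_1\wedge_\mu G_2$ has degree at least $k$ (the empty matching qualifies vacuously). The $k$-core estimator $(\widehat M_k,\widehat\mu_k)$ is a $k$-core matching of $(G_1,G_2)$ with $|M|$ as large as possible among all $k$-core matchings (ties broken arbitrarily). $p\le n^{-\alpha+o(1)}$ means $p\le n^{-\alpha+\varepsilon_n}$ for some deterministic sequence $\varepsilon_n\to0$. *)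

(* Defs.v *)
From HB Require Import structures.
From mathcomp Require Import all_boot all_order all_fingroup all_algebra.
From mathcomp Require Import all_classical all_reals all_analysis.

Set Implicit Arguments.
Unset Strict Implicit.
Unset Printing Implicit Defensive.

Import Order.TTheory GRing.Theory Num.Theory.
Import numFieldNormedType.Exports.

Local Open Scope classical_set_scope.
Local Open Scope ring_scope.

Section SimpleGraphs.

Definition simple_adj n (a : {ffun 'I_n * 'I_n -> bool}) : bool :=
  [forall i, ~~ a (i, i)] && [forall i, forall j, a (i, j) == a (j, i)].

Record sgraph n := SGraph {
  sgraph_val :> {ffun 'I_n * 'I_n -> bool};
  _ : simple_adj sgraph_val }.

HB.instance Definition _ n := [isSub for @sgraph_val n].
HB.instance Definition _ n := [Finite of sgraph n by <:].

Definition edge n (G : sgraph n) (i j : 'I_n) : bool := sgraph_val G (i, j).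

Lemma edge_irr n (G : sgraph n) i : edge G i i = false.
Proof. by case: G => a aP; case/andP: (aP) => /forallP /(_ i) /negbTE. Qed.

Lemma edge_sym n (G : sgraph n) i j : edge G i j = edge G j i.
Proof.
by case: G => a aP; case/andP: (aP) => _ /forallP /(_ i) /forallP /(_ j) /eqP.
Qed.

Lemma relabel_subproof n (pi : 'S_n) (H : sgraph n) :
  simple_adj [ffun ij : 'I_n * 'I_n => edge H (pi^-1%g ij.1) (pi^-1%g ij.2)].
Proof.
apply/andP; split; first by apply/forallP => i; rewrite ffunE /= edge_irr.
by apply/forallP => i; apply/forallP => j; rewrite !ffunE /= edge_sym.
Qed.

Definition relabel n (pi : 'S_n) (H : sgraph n) : sgraph n :=
  SGraph (relabel_subproof pi H).

Lemma edge_relabel n (pi : 'S_n) (H : sgraph n) i j :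
  edge (relabel pi H) (pi i) (pi j) = edge H i j.
Proof. by rewrite /edge /= ffunE /= !permK. Qed.

End SimpleGraphs.

Section Geometry.
Context {R : realType}.

(* The norm that the library puts on 'rV[R]_d is the sup norm, hence this
   definition of the Euclidean norm. *)
Definition enorm d (v : 'rV[R]_d) : R := Num.sqrt (\sum_(i < d) v 0 i ^+ 2).

Definition usphere d : set 'rV[R]_d := [set v | enorm v = 1].

(* The minimum over the vertices i of #{j : |x_i - x_j| <= r}, where j = i is
   counted; no count exceeds n, so the default value n of the iterated minimum
   has no effect for n > 0. *)
Definition min_nbhd n d (x : 'I_n -> 'rV[R]_d) (r : R) : nat :=
  \big[minn/n]_(i < n) #|[set j : 'I_n | enorm (x i - x j) <= r]%SET|.

End Geometry.

Section CorrelatedModel.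
Context {R : realType}.

Definition edge_prob n d (x : 'I_n -> 'rV[R]_d) (r p : R) (i j : 'I_n) : R :=
  p * (enorm (x i - x j) <= r)%R%:R.

(* Unordered pairs of distinct vertices are represented by the (i, j) with
   i < j. *)
Definition rgg_pmf n d (x : 'I_n -> 'rV[R]_d) (r p : R) (G : sgraph n) : R :=
  \prod_(i < n) \prod_(j < n | (i < j)%N)
    bernoulli_pmf (edge_prob x r p i j) (edge G i j).

(* Conditional probability of H given that the parent graph is G: a non-edge of
   G is kept with probability 0. *)
Definition subsample_pmf n (s : R) (G H : sgraph n) : R :=
  \prod_(i < n) \prod_(j < n | (i < j)%N)
    bernoulli_pmf (s * (edge G i j)%:R) (edge H i j).

(* Outcomes are the quadruples (G, G_1, G_2', pi_star). *)
Definition outcome n : finType :=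
  (sgraph n * sgraph n * sgraph n * 'S_n)%type.

Definition out_G n (w : outcome n) : sgraph n := w.1.1.1.
Definition out_G1 n (w : outcome n) : sgraph n := w.1.1.2.
Definition out_G2' n (w : outcome n) : sgraph n := w.1.2.
Definition out_pi n (w : outcome n) : 'S_n := w.2.

Definition out_G2 n (w : outcome n) : sgraph n := relabel (out_pi w) (out_G2' w).

Definition crgg_pmf n d (x : 'I_n -> 'rV[R]_d) (r p s : R) (w : outcome n) : R :=
  rgg_pmf x r p (out_G w)
  * subsample_pmf s (out_G w) (out_G1 w)
  * subsample_pmf s (out_G w) (out_G2' w)
  * (n`!)%:R^-1.

Definition crgg_prob n d (x : 'I_n -> 'rV[R]_d) (r p s : R)
    (A : pred (outcome n)) : R :=
  \sum_(w : outcome n | A w) crgg_pmf x r p s w.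

End CorrelatedModel.

Section Matchings.

(* The values of mmap outside mdom are irrelevant: nothing below looks at
   them. *)
Record matching n := Matching {
  mdom : {set 'I_n};
  mmap : 'I_n -> 'I_n;
  mmap_inj : {in mdom &, injective mmap} }.

Definition inter_edge n (G1 G2 : sgraph n) (m : matching n) (i j : 'I_n) : bool :=
  edge G1 i j && edge G2 (mmap m i) (mmap m j).

Definition inter_deg n (G1 G2 : sgraph n) (m : matching n) (i : 'I_n) : nat :=
  #|[set j in mdom m | inter_edge G1 G2 m i j]%SET|.

Definition kcore_matching k n (G1 G2 : sgraph n) (m : matching n) : Prop :=
  forall i, i \in mdom m -> (k <= inter_deg G1 G2 m i)%N.

(* est is a k-core estimator for some rule of breaking ties. *)
Definition kcore_estimator k n (est : sgraph n -> sgraph n -> matching n) : Prop :=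
  forall G1 G2 : sgraph n,
    kcore_matching k G1 G2 (est G1 G2) /\
    (forall m : matching n, kcore_matching k G1 G2 m ->
       (#|mdom m| <= #|mdom (est G1 G2)|)%N).

Definition matching_is_perm n (m : matching n) (pi : 'S_n) : bool :=
  (mdom m == [set: 'I_n]%SET) && [forall i, mmap m i == pi i].

End Matchings.

(* Main.v *)
Require Import Defs.
From HB Require Import structures.
From mathcomp Require Import all_boot all_order all_fingroup all_algebra.
From mathcomp Require Import all_classical all_reals all_analysis.
From mathcomp Require Import zify.
From mathcomp Require Import ring lra.
Import Order.TTheory GRing.Theory Num.Theory.
Import numFieldNormedType.Exports.
Local Open Scope classical_set_scope.
Local Open Scope ring_scope.
Set Implicit Arguments.
Unset Strict Implicit.
Unset Printing Implicit Defensive.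

(** The latent permutation fails to be recovered only if one of two unlikely
    events occurs, and neither of them involves the permutation itself
    ([estimator_correct]). Outside the first event every vertex has degree at
    least [k] in the true intersection graph, so the latent permutation is itself
    a k-core matching of all vertices; the estimator, being at least as large, is
    then a permutation of all vertices, and a union bound over permutations,
    rather than over partial matchings, is enough. Outside the second event no
    other permutation has all its degrees at least [k], so the estimator is the
    latent permutation.

    First event. The true degree of a vertex is binomial with mean at least
    [(1 + eps) log n] up to a bounded error, so a Chernoff bound makes it smaller
    than the constant [k] with probability [O(n^(-1 - eps/2))]
    ([low_degree_expect]), and the union bound over vertices gives
    [O(n^(-eps/2))].

    Second event. Let a relabelling [sigma] move [j] vertices. If all degrees
    are at least [k > 6 c] after relabelling, there are [c j] pairs [S] of
    vertices, each containing a moved vertex, such that [S] and [sigma S] are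
    disjoint, the first graph contains [S] and the second contains [sigma S]
    ([dense_agreement_witness]). The disjointness makes the [2 c j] edges
    independent, so this has probability at most [p^(2 c j)] for each [S]
    ([agreement_pattern_expect]). There are at most ['C(j n, c j) <= n^(c j) e^j]
    sets [S] and at most [n^j] permutations moving [j] points, hence the total
    probability is at most the sum over [j >= 1] of [(e n (n p^2)^c)^j]. As
    [p <= n^(- alpha + o(1))], the ratio is [n^(1 - c (2 alpha - 1) + o(1))],
    which tends to 0 because [k > 12 / (2 alpha - 1)] allows
    [c (2 alpha - 1) > 1].

    Probabilities are computed from [graphs_expect_prod]: the expectation of a
    product over pairs of vertices is the product of the local expectations. *)

(** * Extracting disjoint sets *)

Section FinsetExtraction.
Import mathcomp.boot.finset.
Local Open Scope set_scope.
Local Open Scope nat_scope.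

(** A subset [S] of [A], maximal among those disjoint from their image, catches
    a third of [A]: an element of [A] that lies neither in [S] nor in [f @: S],
    and whose image is not in [S], could be added to [S]. *)
Lemma greedy_disjoint (T : finType) (f : T -> T) (A : {set T}) :
  {in A &, injective f} -> (forall e, e \in A -> f e != e) ->
  exists S : {set T}, [/\ S \subset A, S :&: f @: S = set0 & #|A| <= 3 * #|S|].
Proof.
move=> finj fne.
pose P (S : {set T}) := (S \subset A) && (S :&: f @: S == set0).
have [|S /maxsetP[/andP[SA /eqP dS] Smax]] := @ex_maxset _ P.
  by exists set0; rewrite /P sub0set imset0 setI0 eqxx.
exists S; split => //.
pose C := [set e in A | f e \in S].
have cC : #|C| <= #|S|.
  rewrite -(@card_in_imset _ _ f).
    by apply/subset_leq_card/fintype.subsetP => _ /imsetP[e /[!inE] /andP[_ ?] ->].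
  by move=> a b /[!inE] /andP[aA _] /andP[bA _]; exact: finj.
have cA : A \subset S :|: f @: S :|: C.
  apply/fintype.subsetP => e eA; rewrite !inE eA /=.
  case: (boolP (e \in S)) => //= eS; case: (boolP (e \in f @: S)) => //= efS.
  apply: contraNT eS => feS.
  have <- : e |: S = S; last by rewrite setU11.
  apply: Smax; last exact: subsetUr.
  rewrite /P subUset sub1set eA SA /= imsetU1.
  apply/eqP/setP => a; rewrite !inE; apply/negP => /andP[/orP[/eqP->|aS]].
    by rewrite (negPf efS) orbF eq_sym (negPf (fne _ eA)).
  case/orP => [/eqP ea|]; first by rewrite ea (negPf feS) in aS.
  by move=> aS'; move/setP/(_ a): dS; rewrite !inE aS aS'.
have := subset_leq_card cA.
have := (leq_card_setU (S :|: f @: S) C).1; have := (leq_card_setU S (f @: S)).1.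
have := leq_imset_card f S; lia.
Qed.

Lemma subset_of_card (T : finType) (A : {set T}) m : m <= #|A| ->
  exists2 B : {set T}, B \subset A & #|B| == m.
Proof.
move=> mA; have : 0 < #|[set B : {set T} | B \subset A & #|B| == m]|.
  by rewrite cards_draws bin_gt0.
by case/card_gt0P => B; rewrite inE => /andP[? ?]; exists B.
Qed.

End FinsetExtraction.

(** * Agreements of two graphs under a relabelling *)

Section PairAction.
Import mathcomp.boot.finset.
Local Open Scope set_scope.
Local Open Scope nat_scope.
Context {n : nat}.
Implicit Types (e f : 'I_n * 'I_n) (sigma : 'S_n) (H : sgraph n).

(** An unordered pair of vertices is represented by its increasing ordering,
    because the edge variables of the model are indexed in this way; [pair_act]
    is the resulting action of a permutation on unordered pairs. *)
Definition upair : pred ('I_n * 'I_n) := fun e => e.1 < e.2.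

Definition sort_pair e := if e.1 < e.2 then e else (e.2, e.1).

Definition pair_act sigma e := sort_pair (sigma e.1, sigma e.2).

Definition pedge H e := edge H e.1 e.2.

Definition moved sigma : {set 'I_n} := [set i | sigma i != i].

Definition moved_pairs sigma : {set 'I_n * 'I_n} :=
  [set e | upair e && ((e.1 \in moved sigma) || (e.2 \in moved sigma))].

Lemma pedge_sort H e : pedge H (sort_pair e) = pedge H e.
Proof. by rewrite /pedge /sort_pair; case: ifP => //= _; rewrite edge_sym. Qed.

Lemma sort_pair_eq e f : sort_pair e = sort_pair f -> e = f \/ e = (f.2, f.1).
Proof.
case: e f => [a b] [c d]; rewrite /sort_pair /=.
by case: ifP => _; case: ifP => _ [-> ->]; [left|right|right|left].
Qed.

Lemma pair_act_inj sigma : {in upair &, injective (pair_act sigma)}.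
Proof.
move=> [a b] [c d]; rewrite /upair !unfold_in /= => ab cd.
case/sort_pair_eq => -[] /perm_inj ea /perm_inj eb; subst => //.
by move: ab; rewrite ltnNge ltnW.
Qed.

Lemma upair_act sigma e : upair e -> upair (pair_act sigma e).
Proof.
case: e => a b; rewrite /upair /pair_act /sort_pair /= => ab.
case: ifP => //= /negbT; rewrite -leqNgt leq_eqVlt => /orP[|//].
by rewrite val_eqE (inj_eq perm_inj) -val_eqE gtn_eqF.
Qed.

(** Listing a moved endpoint first embeds these pairs in the product of
    [moved sigma] with the whole vertex set. *)
Lemma card_moved_pairs sigma : #|moved_pairs sigma| <= #|moved sigma| * n.
Proof.
pose f e := if e.1 \in moved sigma then e else (e.2, e.1).
have finj : {in moved_pairs sigma &, injective f}.
  move=> [a b] [c d]; rewrite !inE /upair /f /= !inE => /andP[ab _] /andP[cd _].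
  case: ifP => _; case: ifP => _ [ea eb]; subst => //.
    by move: ab; rewrite ltnNge ltnW.
  by move: ab; rewrite ltnNge ltnW.
rewrite -(card_in_imset finj).
have -> : #|moved sigma| * n = #|setX (moved sigma) [set: 'I_n]|.
  by rewrite cardsX cardsT card_ord.
apply/subset_leq_card/fintype.subsetP => _ /imsetP[e + ->]; rewrite !inE /f.
case/andP=> _; case: ifP => [|/negbT]; rewrite ?inE => ae; first by rewrite ae.
by rewrite (negPf ae) /= => ->.
Qed.

(** The combinatorial core. If a relabelling [sigma] makes the two graphs agree
    on at least [6 * c + 1] edges at every vertex, then it makes them agree on
    [c * #|moved sigma|] pairs whose edge variables are all distinct.

    At a moved vertex [i] only the pair [{i, sigma i}] can be fixed by [sigma], so at
    least [6 * c] agreeing pairs are not fixed. Counting them from both ends costs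
    a factor 2, and making the chosen set disjoint from its image under [sigma]
    costs a factor 3. *)
Lemma dense_agreement_witness c sigma H1 H2 :
  (forall i, 6 * c + 1 <= #|[set j | edge H1 i j && edge H2 (sigma i) (sigma j)]|) ->
  exists S : {set 'I_n * 'I_n},
    [/\ S \subset moved_pairs sigma, #|S| == c * #|moved sigma|,
        S :&: pair_act sigma @: S = set0 &
        forall e, e \in S -> pedge H1 e && pedge H2 (pair_act sigma e)].
Proof.
move=> Hdeg.
pose T := [set e in moved_pairs sigma |
  [&& pedge H1 e, pedge H2 (pair_act sigma e) & pair_act sigma e != e]].
pose N i := [set j | [&& edge H1 i j, edge H2 (sigma i) (sigma j)
  & pair_act sigma (i, j) != sort_pair (i, j)]].
(* [D] lists the agreeing pairs by their moved end, so a pair may occur in it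
   in both orders; [T] keeps one order of each. *)
pose D := [set e | (e.1 \in moved sigma) && (e.2 \in N e.1)].
have cN i : i \in moved sigma -> 6 * c <= #|N i|.
  rewrite inE => si.
  have sub : [set j | edge H1 i j && edge H2 (sigma i) (sigma j)] \subset sigma i |: N i.
    apply/fintype.subsetP => j; rewrite !inE => /andP[-> ->] /=.
    rewrite orbC; case: eqP => //= /sort_pair_eq[] [] ei ej.
      by rewrite ei eqxx in si.
    by rewrite ei eqxx.
  have := leq_trans (Hdeg i) (subset_leq_card sub).
  by rewrite cardsU1; case: (_ \notin _); lia.
have cD : 6 * c * #|moved sigma| <= #|D|.
  have -> : #|D| = \sum_(i in moved sigma) \sum_(j in N i) 1.
    rewrite pair_big_dep /= -sum1_card; apply: eq_bigl => e; by rewrite !inE.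
  rewrite mulnC -sum_nat_const; apply: leq_sum => i /cN.
  by rewrite sum1_card.
have cDT : #|D| <= 2 * #|T|.
  pose swap e : 'I_n * 'I_n := (e.2, e.1).
  have sub : D \subset T :|: swap @: T.
    apply/fintype.subsetP => -[i j]; rewrite !inE /= => /and4P[im h1 h2 ne].
    case: (ltngtP i j) => [ij|ij|/val_inj ij]; last by rewrite ij edge_irr in h1.
      apply/orP; left; rewrite /upair /pedge /= ij im h1 /=.
      have := pedge_sort H2 (sigma i, sigma j); rewrite /pedge /= => -> /=; rewrite h2.
      by move: ne; rewrite {1}/sort_pair /= ij.
    apply/orP; right; apply/imsetP; exists (j, i) => //.
    rewrite !inE /upair /= ij im orbT /pedge /= edge_sym h1 /=.
    have := pedge_sort H2 (sigma j, sigma i); rewrite /pedge /= => ->.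
    rewrite /= edge_sym h2 /=; apply: contra ne => /eqP e1.
    have sij : sort_pair (i, j) = (j, i) by rewrite /sort_pair /= ltnNge ltnW.
    rewrite sij -e1 /pair_act /sort_pair /=.
    by case: (ltngtP (sigma i) (sigma j)) => //= /val_inj ->.
  apply: leq_trans (subset_leq_card sub) _.
  apply: leq_trans (leq_card_setU _ _).1 _.
  by rewrite mul2n -addnn leq_add2l; exact: leq_imset_card.
have [||S0 [S0T S0d cS0]] := @greedy_disjoint _ (pair_act sigma) T.
- by move=> a b /[!inE] /andP[/andP[ua _] _] /andP[/andP[ub _] _]; exact: pair_act_inj.
- by move=> e /[!inE] /and4P[].
have [|S SS0 cS] := @subset_of_card _ S0 (c * #|moved sigma|).
  rewrite -(@leq_pmul2l 6) // mulnA; apply: leq_trans cD _.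
  by apply: leq_trans cDT _; rewrite -[6]/(2 * 3) -mulnA leq_pmul2l.
exists S; split => //.
- apply/fintype.subsetP => e /(fintype.subsetP SS0) /(fintype.subsetP S0T); by rewrite inE => /andP[].
- by apply/eqP; rewrite -subset0 -S0d setISS // imsetS.
by move=> e /(fintype.subsetP SS0) /(fintype.subsetP S0T); rewrite inE => /and4P[_ -> ->].
Qed.

End PairAction.

(** * Expectations under the correlated model *)

Section ProductFormula.
Context {R : realType} {n : nat}.
Implicit Types (e : 'I_n * 'I_n) (G H : sgraph n).

(* The inverse of the restriction of an adjacency function to increasing
   pairs. *)
Let ext_adj (f : {ffun 'I_n * 'I_n -> bool}) : {ffun 'I_n * 'I_n -> bool} :=
  [ffun e => upair (sort_pair e) && f (sort_pair e)].

Let ext_adjP f : simple_adj (ext_adj f).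
Proof.
apply/andP; split; first by apply/forallP => i; rewrite ffunE /sort_pair /upair /= !ltnn.
apply/forallP => i; apply/forallP => j; rewrite !ffunE /sort_pair /upair /=.
by case: (ltngtP i j) => /= [_|_|/val_inj ->]; rewrite ?eqxx.
Qed.

(** A simple graph is a free choice of one boolean for each increasing pair, so
    a sum over graphs of a product over pairs factorizes. *)
Lemma sum_sgraph_prod (h : 'I_n * 'I_n -> bool -> R) :
  \sum_(G : sgraph n) \prod_(e | upair e) h e (pedge G e) =
  \prod_(e | upair e) (h e true + h e false).
Proof.
transitivity (\prod_(e | upair e) \sum_(b : bool) h e b); last first.
  by apply: eq_bigr => e _; rewrite big_bool.
rewrite (big_distr_big false) /=.
pose phi (G : sgraph n) : {ffun 'I_n * 'I_n -> bool} := [ffun e => upair e && pedge G e].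
have phiP G : phi G \in pffun_on false (@upair n) predT.
  apply/pfamilyP; split => //; apply/fintype.subsetP => e.
  by rewrite unfold_in ffunE eqbF_neg negbK => /andP[].
rewrite (reindex phi) /=.
  rewrite [RHS](eq_bigl xpredT) //; apply: eq_bigr => G _.
  by apply: eq_bigr => e ue; rewrite ffunE ue.
exists (fun f => SGraph (ext_adjP f)).
  move=> G _; apply: val_inj; apply/ffunP => -[i j] /=; rewrite /ext_adj ffunE ffunE.
  rewrite andbA andbb pedge_sort /pedge /edge /= /upair /sort_pair /=.
  case: (ltngtP i j) => /= [->|->|/ord_inj ->] //.
  by rewrite ltnn -/(edge G j j) edge_irr.
move=> f /pfamilyP[/fintype.subsetP fs _]; apply/ffunP => e; rewrite ffunE /pedge /edge /=.
rewrite ffunE /=; case: (boolP (upair e)) => ue /=.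
  have -> : sort_pair (e.1, e.2) = e by case: e ue => a b; rewrite /upair /sort_pair /= => ->.
  by rewrite ue.
by apply/esym/negbTE; apply: contra ue => fe; apply: fs; rewrite unfold_in fe.
Qed.

End ProductFormula.

Section Expectation.
Context {R : realType} {n d : nat}.
Variables (x : 'I_n -> 'rV[R]_d) (r p s : R).
Implicit Types (e : 'I_n * 'I_n) (G H : sgraph n) (f g : sgraph n -> sgraph n -> R).

Definition pair_prob e : R := edge_prob x r p e.1 e.2.

(** Expectation over the pair of subsampled graphs, before relabelling. The
    permutation is independent of them and is integrated out in
    [crgg_sum_graphs]; the sums are nested so that the parent graph and its two
    subsamples can be factorized one after the other. *)
Definition graphs_expect f : R :=
  \sum_(G : sgraph n) rgg_pmf x r p G *
    \sum_(H1 : sgraph n) subsample_pmf s G H1 *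
      \sum_(H2 : sgraph n) subsample_pmf s G H2 * f H1 H2.

Lemma rgg_pmfE G :
  rgg_pmf x r p G = \prod_(e | upair e) bernoulli_pmf (pair_prob e) (pedge G e).
Proof. by rewrite /rgg_pmf pair_big_dep. Qed.

Lemma subsample_pmfE G H : subsample_pmf s G H =
  \prod_(e | upair e) bernoulli_pmf (s * (pedge G e)%:R) (pedge H e).
Proof. by rewrite /subsample_pmf pair_big_dep. Qed.

(** Independence of the pairs of vertices: an observable that is a product over
    pairs has for expectation the product of the expectations at each pair. All
    probability estimates below go through this identity. *)
Lemma graphs_expect_prod (u : 'I_n * 'I_n -> bool -> bool -> R) :
  graphs_expect (fun H1 H2 => \prod_(e | upair e) u e (pedge H1 e) (pedge H2 e)) =
  \prod_(e | upair e)
    (pair_prob e * (s ^+ 2 * u e true true + s * (1 - s) * (u e true false + u e false true)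
                    + (1 - s) ^+ 2 * u e false false)
     + (1 - pair_prob e) * u e false false).
Proof.
rewrite /graphs_expect.
pose B a b := bernoulli_pmf (s * (a : bool)%:R) b.
pose v2 e a b := B a true * u e b true + B a false * u e b false.
pose v1 e a := B a true * v2 e a true + B a false * v2 e a false.
have sumH2 G H1 : \sum_(H2 : sgraph n) subsample_pmf s G H2 *
    \prod_(e | upair e) u e (pedge H1 e) (pedge H2 e) =
    \prod_(e | upair e) v2 e (pedge G e) (pedge H1 e).
  rewrite -(sum_sgraph_prod (fun e c => B (pedge G e) c * u e (pedge H1 e) c)).
  by apply: eq_bigr => H2 _; rewrite subsample_pmfE -big_split.
have sumH1 G : \sum_(H1 : sgraph n) subsample_pmf s G H1 *
    \prod_(e | upair e) v2 e (pedge G e) (pedge H1 e) =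
    \prod_(e | upair e) v1 e (pedge G e).
  rewrite -(sum_sgraph_prod (fun e b => B (pedge G e) b * v2 e (pedge G e) b)).
  by apply: eq_bigr => H1 _; rewrite subsample_pmfE -big_split.
transitivity (\sum_(G : sgraph n) \prod_(e | upair e)
    (bernoulli_pmf (pair_prob e) (pedge G e) * v1 e (pedge G e))).
  apply: eq_bigr => G _; rewrite rgg_pmfE big_split -sumH1 /=; congr (_ * _).
  by apply: eq_bigr => H1 _; rewrite sumH2.
rewrite (sum_sgraph_prod (fun e a => bernoulli_pmf (pair_prob e) a * v1 e a)).
apply: eq_bigr => e _; rewrite /v1 /v2 /B /bernoulli_pmf /=; ring.
Qed.

Lemma graphs_expect_sum (I : Type) (l : seq I) (P : pred I) (F : I -> sgraph n -> sgraph n -> R) :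
  graphs_expect (fun H1 H2 => \sum_(i <- l | P i) F i H1 H2) =
  \sum_(i <- l | P i) graphs_expect (F i).
Proof.
rewrite /graphs_expect exchange_big /=; apply: eq_bigr => G _.
rewrite -mulr_sumr exchange_big /=; congr (_ * _); apply: eq_bigr => H1 _.
rewrite -mulr_sumr exchange_big /=; congr (_ * _); apply: eq_bigr => H2 _.
by rewrite -mulr_sumr.
Qed.

Lemma graphs_expectZ a f :
  graphs_expect (fun H1 H2 => a * f H1 H2) = a * graphs_expect f.
Proof.
rewrite /graphs_expect mulr_sumr; apply: eq_bigr => G _; rewrite mulrCA; congr (_ * _).
rewrite mulr_sumr; apply: eq_bigr => H1 _; rewrite mulrCA; congr (_ * _).
by rewrite mulr_sumr; apply: eq_bigr => H2 _; rewrite mulrCA.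
Qed.

Lemma graphs_expectD f g :
  graphs_expect (fun H1 H2 => f H1 H2 + g H1 H2) = graphs_expect f + graphs_expect g.
Proof.
rewrite /graphs_expect -big_split; apply: eq_bigr => G _ /=; rewrite -mulrDr; congr (_ * _).
rewrite -big_split; apply: eq_bigr => H1 _ /=; rewrite -mulrDr; congr (_ * _).
by rewrite -big_split; apply: eq_bigr => H2 _ /=; rewrite -mulrDr.
Qed.

Lemma graphs_expect1 : graphs_expect (fun _ _ => 1) = 1.
Proof.
have E : (fun _ _ : sgraph n => 1 : R) = (fun H1 H2 : sgraph n => \prod_(e : 'I_n * 'I_n | upair e) (1 : R)).
  by apply/funext => H1; apply/funext => H2; rewrite big1.
rewrite [X in graphs_expect X]E (graphs_expect_prod (fun _ _ _ => 1)).
by rewrite big1 // => e _; ring.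
Qed.

Hypotheses (hp : 0 <= p <= 1) (hs : 0 <= s <= 1).

Lemma pair_prob_ge0 e : 0 <= pair_prob e.
Proof. by rewrite /pair_prob /edge_prob mulr_ge0 // ?ler0n //; case/andP: hp. Qed.

Lemma pair_prob_le e : pair_prob e <= p.
Proof.
by rewrite /pair_prob /edge_prob ler_piMr ?lern1 ?leq_b1 //; case/andP: hp.
Qed.

Lemma rgg_pmf_ge0 G : 0 <= rgg_pmf x r p G.
Proof.
rewrite rgg_pmfE prodr_ge0 // => e _; apply: bernoulli_pmf_ge0.
rewrite pair_prob_ge0 (le_trans (pair_prob_le _)) //; by case/andP: hp.
Qed.

Lemma subsample_pmf_ge0 G H : 0 <= subsample_pmf s G H.
Proof.
rewrite subsample_pmfE prodr_ge0 // => e _; apply: bernoulli_pmf_ge0.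
by case: (pedge G e); rewrite ?mulr1 ?mulr0 ?lexx ?ler01.
Qed.

Lemma le_graphs_expect f g : (forall H1 H2, f H1 H2 <= g H1 H2) ->
  graphs_expect f <= graphs_expect g.
Proof.
move=> fg; apply: ler_sum => G _; apply: ler_wpM2l; first exact: rgg_pmf_ge0.
apply: ler_sum => H1 _; apply: ler_wpM2l; first exact: subsample_pmf_ge0.
apply: ler_sum => H2 _; apply: ler_wpM2l; first exact: subsample_pmf_ge0.
exact: fg.
Qed.

Lemma crgg_sum_graphs f :
  \sum_(w : outcome n) crgg_pmf x r p s w * f (out_G1 w) (out_G2' w) = graphs_expect f.
Proof.
transitivity (\sum_(t : sgraph n * sgraph n * sgraph n) \sum_(pi : 'S_n)
    rgg_pmf x r p t.1.1 * subsample_pmf s t.1.1 t.1.2 * subsample_pmf s t.1.1 t.2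
    * (n`!)%:R^-1 * f t.1.2 t.2).
  by rewrite pair_bigA; apply: eq_bigr => -[[[G H1] H2] pi].
transitivity (\sum_(t : sgraph n * sgraph n * sgraph n)
    rgg_pmf x r p t.1.1 * (subsample_pmf s t.1.1 t.1.2 *
      (subsample_pmf s t.1.1 t.2 * f t.1.2 t.2))).
  apply: eq_bigr => t _; rewrite sumr_const card_Sn -[LHS]mulr_natr mulrAC.
  by rewrite divfK ?pnatr_eq0 -?lt0n ?fact_gt0 // -!mulrA.
rewrite /graphs_expect.
transitivity (\sum_(t : sgraph n * sgraph n) \sum_(H2 : sgraph n)
   rgg_pmf x r p t.1 * (subsample_pmf s t.1 t.2 * (subsample_pmf s t.1 H2 * f t.2 H2))).
  by rewrite pair_bigA.
transitivity (\sum_(G : sgraph n) \sum_(H1 : sgraph n) \sum_(H2 : sgraph n)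
   rgg_pmf x r p G * (subsample_pmf s G H1 * (subsample_pmf s G H2 * f H1 H2))).
  by rewrite [RHS]pair_bigA.
apply: eq_bigr => G _; rewrite mulr_sumr; apply: eq_bigr => H1 _.
by rewrite !mulr_sumr.
Qed.

Lemma crgg_pmf_ge0 w : 0 <= crgg_pmf x r p s w.
Proof.
by rewrite /crgg_pmf !mulr_ge0 ?rgg_pmf_ge0 ?subsample_pmf_ge0 ?invr_ge0 ?ler0n.
Qed.

(** An event that holds outside a failure event of the two unlabelled graphs is
    at least as likely as the complement of that failure event. *)
Lemma crgg_prob_bounds (A : pred (outcome n)) (bad : sgraph n -> sgraph n -> bool) :
  (forall w, ~~ bad (out_G1 w) (out_G2' w) -> A w) ->
  1 - graphs_expect (fun H1 H2 => (bad H1 H2)%:R) <= crgg_prob x r p s A <= 1.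
Proof.
move=> HA; have tot := crgg_sum_graphs (fun _ _ => 1).
rewrite graphs_expect1 in tot.
rewrite -crgg_sum_graphs /crgg_prob; apply/andP; split.
  rewrite lerBlDr -{1}tot [X in _ <= X + _]big_mkcond -big_split /=.
  apply: ler_sum => w _; have w0 := crgg_pmf_ge0 w; rewrite mulr1.
  case: (boolP (A w)) => Aw; first by rewrite lerDl mulr_ge0 ?ler0n.
  by rewrite add0r (_ : bad _ _) ?mulr1 //; apply: contraR Aw; exact: HA.
rewrite -[leRHS]tot big_mkcond /=; apply: ler_sum => w _; rewrite mulr1.
by case: ifP => // _; exact: crgg_pmf_ge0.
Qed.

End Expectation.

(** * Probability bounds for low degrees and for misalignments *)

Section Bounds.
Context {R : realType} {n d : nat}.
Variables (x : 'I_n -> 'rV[R]_d) (r p s : R).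
Hypotheses (hp : 0 <= p <= 1) (hs : 0 <= s <= 1).
Implicit Types (e : 'I_n * 'I_n) (sigma : 'S_n) (H : sgraph n).

(** The degree of [i] in the intersection graph of [H1] with [H2] pulled back
    along [sigma]; for [sigma = 1] it is the degree in the true intersection. *)
Definition agree_deg sigma H1 H2 (i : 'I_n) : nat :=
  #|[set j | edge H1 i j && edge H2 (sigma i) (sigma j)]%SET|.

(** The pairs that contain a given vertex are indexed by their other end. *)
Lemma prod_incident (i : 'I_n) (g : 'I_n * 'I_n -> R) :
  \prod_(e | upair e) (if (e.1 == i) || (e.2 == i) then g e else 1) =
  \prod_(j | j != i) g (sort_pair (i, j)).
Proof.
rewrite -big_mkcondr /=.
rewrite (reindex_onto (fun j => sort_pair (i, j)) (fun e => if e.1 == i then e.2 else e.1)) /=.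
  apply: eq_bigl => j; rewrite /sort_pair /upair /=.
  case: (ltngtP i j) => [ij|ij|/ord_inj <-] /=; rewrite ?ij ?eqxx ?ltnn //=.
  - by have -> : (j == i) = false by rewrite -val_eqE gtn_eqF.
  - have -> : (j == i) = false by rewrite -val_eqE ltn_eqF.
    by rewrite eqxx.
move=> [a b]; rewrite /upair /sort_pair /= => /andP[ab].
case: eqP => [<-|_] /=; first by rewrite ab.
by move=> /eqP bi; rewrite -bi ltnNge ltnW.
Qed.

Lemma pair_prob_sort e : pair_prob x r p (sort_pair e) = pair_prob x r p e.
Proof.
rewrite /sort_pair; case: ifP => //= _; rewrite /pair_prob /edge_prob /=.
congr (_ * (_ <= _)%R%:R); rewrite /enorm; congr Num.sqrt; apply: eq_bigr => l _.
by rewrite !mxE -sqrrN opprB.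
Qed.

(** Chernoff bound: for [t <= 1] the indicator of [deg < k] is at most
    [t ^- k * t ^+ deg], and [t ^+ deg] is a product over the pairs that contain
    [i], each of which contributes [1 - p s^2 (1 - t)] when it is a short pair.
    The [- 1] discounts the vertex [i] itself from its neighbourhood. *)
Lemma low_degree_expect (k : nat) (t : R) (i : 'I_n) : 0 < t <= 1 ->
  graphs_expect x r p s (fun H1 H2 => (agree_deg 1%g H1 H2 i < k)%N%:R) <=
  t ^- k * expR (- ((1 - t) * (p * s ^+ 2) *
    (#|[set j : 'I_n | (enorm (x i - x j) <= r)%R]%SET|%:R - 1))).
Proof.
move=> /andP[t0 t1].
pose u e (b c : bool) : R := if (e.1 == i) || (e.2 == i) then (if b && c then t else 1) else 1.
have powdeg H1 H2 : \prod_(e | upair e) u e (pedge H1 e) (pedge H2 e) =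
    t ^+ agree_deg 1%g H1 H2 i.
  rewrite /u (prod_incident i (fun e => if pedge H1 e && pedge H2 e then t else 1)).
  rewrite -big_mkcondr prodr_const; congr (_ ^+ _).
  apply: eq_card => j; rewrite !inE !perm1 [LHS]unfold_in /= !pedge_sort /pedge /=.
  by case: eqVneq => // ->; rewrite edge_irr.
apply: (@le_trans _ _ (graphs_expect x r p s (fun H1 H2 => t ^- k *
    \prod_(e | upair e) u e (pedge H1 e) (pedge H2 e)))).
  apply: le_graphs_expect => // H1 H2; rewrite powdeg.
  case: ltnP => [lk|_]; last by rewrite mulr_ge0 // ?invr_ge0 exprn_ge0 // ltW.
  rewrite mulrC ler_pdivlMr ?exprn_gt0 // mul1r.
  by apply: ler_wiXn2l; rewrite ?(ltW t0) // ltnW.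
rewrite graphs_expectZ ler_wpM2l ?invr_ge0 ?exprn_ge0 ?(ltW t0) //.
rewrite graphs_expect_prod.
pose g e := 1 - pair_prob x r p e * s ^+ 2 * (1 - t).
rewrite (eq_bigr (fun e => if (e.1 == i) || (e.2 == i) then g e else 1)); last first.
  by move=> e _; rewrite /u /g; case: ifP => _ /=; ring.
rewrite prod_incident.
apply: (@le_trans _ _ (\prod_(j | j != i) expR (- (pair_prob x r p (i, j) * s ^+ 2 * (1 - t))))).
  apply: ler_prod => j _; rewrite /g pair_prob_sort expR_ge1Dx andbT.
  rewrite subr_ge0 -mulrA mulr_ile1 //.
  - exact: pair_prob_ge0.
  - by rewrite mulr_ge0 ?sqr_ge0 ?subr_ge0.
  - by rewrite (le_trans (pair_prob_le _ _ hp _)) //; case/andP: hp.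
  - case/andP: hs => s0 s1; rewrite mulr_ile1 ?sqr_ge0 ?subr_ge0 ?exprn_ile1 //.
    by rewrite lerBlDr lerDl ltW.
rewrite -expR_sum ler_expR sumrN lerN2.
have -> : \sum_(j | j != i) pair_prob x r p (i, j) * s ^+ 2 * (1 - t) =
   (1 - t) * (p * s ^+ 2) * \sum_(j | j != i) (enorm (x i - x j) <= r)%R%:R.
  rewrite mulr_sumr; apply: eq_bigr => j _; rewrite /pair_prob /edge_prob /=; ring.
apply: ler_wpM2l.
  rewrite mulr_ge0 ?subr_ge0 // mulr_ge0 ?sqr_ge0 //; by case/andP: hp.
rewrite lerBlDr.
have -> : #|[set j : 'I_n | (enorm (x i - x j) <= r)%R]%SET|%:R =
    \sum_j (enorm (x i - x j) <= r)%R%:R :> R.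
  rewrite -sum1_card natr_sum big_mkcond; apply: eq_bigr => j _.
  by rewrite inE; case: ifP.
by rewrite (bigD1 i) //= addrC lerD2l lern1 leq_b1.
Qed.

(** Since [S] and its image are disjoint, the event prescribes one edge of one
    graph at each of [2 * #|S|] different pairs; these edges are independent and
    each is present with probability at most [p]. *)
Lemma agreement_pattern_expect sigma (S : {set 'I_n * 'I_n}) :
  S \subset moved_pairs sigma ->
  mathcomp.boot.finset.setI S (pair_act sigma @: S)%SET = finset.set0 ->
  graphs_expect x r p s (fun H1 H2 =>
    [forall e in S, pedge H1 e && pedge H2 (pair_act sigma e)]%:R) <= p ^+ (2 * #|S|).
Proof.
move=> SM Sdis; pose T := (pair_act sigma @: S)%SET.
have Sup e : e \in S -> upair e by move=> /(fintype.subsetP SM) /[!inE] /andP[].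
have ST e : e \in S -> e \in T -> False.
  by move=> eS eT; move/setP/(_ e): Sdis; rewrite !inE eS eT.
pose u e (b c : bool) : R := ((e \in S) ==> b)%:R * ((e \in T) ==> c)%:R.
apply: (@le_trans _ _ (graphs_expect x r p s (fun H1 H2 =>
    \prod_(e | upair e) u e (pedge H1 e) (pedge H2 e)))).
  apply: le_graphs_expect => // H1 H2.
  case: (boolP [forall e in S, _]) => [/forall_inP SH|_]; last first.
    by rewrite prodr_ge0 // => e _; rewrite mulr_ge0 ?ler0n.
  rewrite big1 // => e _; rewrite /u.
  have -> : (e \in S) ==> pedge H1 e by apply/implyP => /SH /andP[].
  have -> : (e \in T) ==> pedge H2 e; last by rewrite mulr1.
  by apply/implyP => /imsetP[f /SH /andP[_ ?] ->].
have /andP[p0 p1] := hp; have /andP[s0 s1] := hs.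
rewrite graphs_expect_prod.
apply: (@le_trans _ _ (\prod_(e | upair e) if e \in (finset.setU S T) then p else 1)).
  apply: ler_prod => e _; have q0 : 0 <= pair_prob x r p e by apply: pair_prob_ge0; rewrite p0.
  have qp : pair_prob x r p e <= p by apply: pair_prob_le; rewrite p0.
  have qs : pair_prob x r p e * s <= p by rewrite (le_trans _ qp) // ler_piMr.
  have qs0 : 0 <= pair_prob x r p e * s by rewrite mulr_ge0.
  rewrite !inE /u; case: (boolP (e \in S)) => eS; case: (boolP (e \in T)) => eT /=.
  - by case: (ST e).
  - by rewrite (_ : _ + _ = pair_prob x r p e * s) ?qs0 //; ring.
  - by rewrite (_ : _ + _ = pair_prob x r p e * s) ?qs0 //; ring.
  - by rewrite (_ : _ + _ = 1) ?ler01 ?lexx //; ring.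
rewrite -big_mkcondr /= prodr_const.
apply: ler_wiXn2l => //.
have -> : #|(fun e => upair e && (e \in finset.setU S T))| = #|finset.setU S T|.
  apply: eq_card => e; rewrite unfold_in /=; apply: andb_idl.
  rewrite inE => /orP[/Sup //|/imsetP[f /Sup fu ->]]; exact: upair_act.
rewrite finset.cardsU Sdis cards0 subn0 mul2n -addnn leq_add2l.
rewrite card_in_imset // => e f /Sup eu /Sup fu; exact: pair_act_inj.
Qed.

(** Union bound over the wrong relabellings and, for each of them, over the
    patterns given by [dense_agreement_witness]. *)
Lemma misaligned_expect (k c : nat) : (6 * c + 1 <= k)%N ->
  graphs_expect x r p s (fun H1 H2 =>
    [exists sigma : 'S_n, (sigma != 1%g) && [forall i, k <= agree_deg sigma H1 H2 i]%N]%:R)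
  <= \sum_(sigma : 'S_n | sigma != 1%g)
       ('C(#|moved sigma| * n, c * #|moved sigma|))%:R * p ^+ (2 * (c * #|moved sigma|)).
Proof.
move=> ck.
pose wit sigma (S : {set 'I_n * 'I_n}) := [&& S \subset moved_pairs sigma,
  #|S| == (c * #|moved sigma|)%N & finset.setI S (pair_act sigma @: S)%SET == finset.set0].
apply: (@le_trans _ _ (graphs_expect x r p s (fun H1 H2 =>
    \sum_(sigma : 'S_n | sigma != 1%g) \sum_(S | wit sigma S)
      [forall e in S, pedge H1 e && pedge H2 (pair_act sigma e)]%:R))).
  apply: le_graphs_expect => // H1 H2.
  case: existsP => [[sigma /andP[s1 /forallP sk]]|_]; last first.
    by apply: sumr_ge0 => sigma _; apply: sumr_ge0 => S _; rewrite ler0n.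
  have [|S [SM Sc Sd SH]] := @dense_agreement_witness n c sigma H1 H2.
    by move=> i; apply: leq_trans ck (sk i).
  rewrite (bigD1 sigma) //= (bigD1 S) /=; last by rewrite /wit SM Sc Sd eqxx.
  have -> : [forall e in S, pedge H1 e && pedge H2 (pair_act sigma e)] by apply/forall_inP.
  rewrite -addrA lerDl addr_ge0 //; first by apply: sumr_ge0 => ? _; rewrite ler0n.
  by apply: sumr_ge0 => ? _; apply: sumr_ge0 => ? _; rewrite ler0n.
rewrite graphs_expect_sum; apply: ler_sum => sigma _.
rewrite graphs_expect_sum.
apply: (@le_trans _ _ (\sum_(S | wit sigma S) p ^+ (2 * (c * #|moved sigma|)))).
  by apply: ler_sum => S /and3P[SM /eqP <- /eqP Sd]; exact: agreement_pattern_expect.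
rewrite sumr_const -[leLHS]mulr_natl ler_wpM2r ?exprn_ge0 //; first by case/andP: hp.
rewrite ler_nat (leq_trans _ (leq_bin2l _ (card_moved_pairs sigma))) //.
rewrite -cards_draws; apply/subset_leq_card/fintype.subsetP => S.
by rewrite unfold_in inE => /and3P[-> -> _].
Qed.

End Bounds.

(** * Counting permutations and patterns *)

Section Counting.

(** From a single term of the expansion of [(1 + 1 / n) ^+ (N * n)]. This avoids
    any estimate of factorials. *)
Lemma bin_le_expR (R : realType) (N n m : nat) : (0 < n)%N ->
  ('C(N * n, m))%:R <= (n%:R : R) ^+ m * expR 1 ^+ N.
Proof.
move=> n0; have n0' : 0 < n%:R :> R by rewrite ltr0n.
have [mN|Nm] := leqP m (N * n); last first.
  by rewrite bin_small // mulr_ge0 // ?exprn_ge0 ?ler0n ?expR_ge0.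
rewrite -ler_pdivrMl ?exprn_gt0 //.
apply: (@le_trans _ _ ((1 + n%:R^-1) ^+ (N * n))).
  rewrite exprDn (bigD1 (Ordinal (mN : (m < (N * n).+1)%N))) //=.
  rewrite expr1n mul1r exprVn -[X in _ <= X + _]mulr_natr lerDl sumr_ge0 //.
rewrite [(N * n)%N]mulnC exprM; apply: lerXn2r; rewrite ?nnegrE ?exprn_ge0 ?expR_ge0 //.
rewrite -[X in expR X](@mulVf _ (n%:R)) ?gt_eqF // expRM_natr.
apply: lerXn2r; rewrite ?nnegrE ?expR_ge0 ?expR_ge1Dx //.
Qed.

Lemma ffact_le_expn n j : (n ^_ j <= n ^ j)%N.
Proof.
rewrite ffact_prod -[X in (_ <= _ ^ X)%N](card_ord j) -prod_nat_const.
by apply: leq_prod => i _; exact: leq_subr.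
Qed.

(** A permutation that moves exactly the points of [F] is one of [#|F|`!]
    permutations supported on [F], and ['C(n, j) * j`!] is a falling
    factorial. *)
Lemma card_moved_le n j : (#|[set sigma : 'S_n | #|moved sigma| == j]%SET| <= n ^ j)%N.
Proof.
apply: leq_trans (ffact_le_expn n j); rewrite -bin_ffact -sum1_card.
rewrite (partition_big (@moved n) (fun F => #|F| == j)) /=; last by move=> sigma; rewrite inE.
have -> : ('C(n, j) * j`! = \sum_(F : {set 'I_n} | #|F| == j) j`!)%N.
  rewrite sum_nat_const -[n in 'C(n, _)]card_ord -card_draws; congr (_ * _)%N.
  by apply: eq_card => F; rewrite inE.
apply: leq_sum => F /eqP Fj; rewrite sum1_card -Fj -card_perm.
apply/subset_leq_card/fintype.subsetP => sigma.
rewrite unfold_in /= => /andP[_ /eqP <-]; apply/fintype.subsetP => i.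
by rewrite !inE.
Qed.

(** The identity is the only permutation that moves nothing, which is why the
    exponents on the right start at 1. *)
Lemma sum_perm_moved (R : realType) n (y : R) : 0 <= y ->
  \sum_(sigma : 'S_n | sigma != 1%g) y ^+ #|moved sigma| <=
  \sum_(j < n) (n%:R * y) ^+ j.+1.
Proof.
move=> y0.
pose h (sigma : 'S_n) : 'I_n.+1 := inord #|moved sigma|.
have hE sigma : h sigma = #|moved sigma| :> nat.
  by rewrite inordK // ltnS -[leqRHS]card_ord max_card.
rewrite (partition_big h (fun j => j != ord0)) /=; last first.
  move=> sigma; apply: contraNneq => h0; apply/eqP/permP => i; rewrite perm1.
  have /eqP := hE sigma; rewrite h0 eq_sym cards_eq0 => /eqP/setP/(_ i).
  by rewrite !inE => /negbFE/eqP.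
apply: (@le_trans _ _ (\sum_(j < n.+1 | j != ord0) (n%:R * y) ^+ j)).
  apply: ler_sum => j _; rewrite exprMn.
  apply: (@le_trans _ _ (\sum_(sigma in [set sigma : 'S_n | #|moved sigma| == j]%SET) y ^+ j)).
    rewrite big_mkcond [leRHS]big_mkcond /=; apply: ler_sum => sigma _.
    rewrite inE -hE val_eqE; case: (h sigma == j) / eqP => [<-|_]; last by rewrite andbF.
    by rewrite hE andbT; case: ifP => // _; rewrite exprn_ge0.
  rewrite sumr_const -[leLHS]mulr_natl ler_wpM2r ?exprn_ge0 // -natrX ler_nat.
  exact: card_moved_le.
by rewrite big_mkcond big_ord_recl /= add0r.
Qed.

Lemma geometric_le (R : realType) m (z : R) : 0 <= z -> 2 * z <= 1 ->
  \sum_(j < m) z ^+ j.+1 <= 2 * z.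
Proof.
move=> z0 z1; elim: m => [|m IH]; first by rewrite big_ord0; lra.
rewrite big_ord_recl expr1.
under eq_bigr => i _ do rewrite /= exprS.
rewrite -mulr_sumr; move: IH; set T := \sum_(i < m) _ => IH.
by rewrite (_ : 2 * z = z + z * 1) ?lerD2l ?ler_wpM2l //; lra.
Qed.

End Counting.

(** * From the failure event to the estimator *)

(** The event outside which the estimator is exact, whatever the permutation:
    either the true intersection graph has a vertex of degree less than [k], or
    some nontrivial relabelling gives an intersection graph with all degrees at
    least [k]. *)
Definition failure (k n : nat) (H1 H2 : sgraph n) : bool :=
  [exists i, (agree_deg 1%g H1 H2 i < k)%N] ||
  [exists sigma : 'S_n, (sigma != 1%g) && [forall i, k <= agree_deg sigma H1 H2 i]%N].

(** When all true degrees are at least [k], the latent permutation is a k-core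
    matching of all the vertices, so a largest one is also a bijection of all the
    vertices. Composed with the inverse of the latent permutation it is a
    relabelling with all degrees at least [k], hence the identity. *)
Lemma estimator_correct (k n : nat) (est : sgraph n -> sgraph n -> matching n) (w : outcome n) :
  kcore_estimator k est -> ~~ failure k (out_G1 w) (out_G2' w) ->
  matching_is_perm (est (out_G1 w) (out_G2 w)) (out_pi w).
Proof.
move=> hest; rewrite /failure negb_or => /andP[/existsPn low /existsPn mis].
have [core maxi] := hest (out_G1 w) (out_G2 w); set m := est _ _ in core maxi *.
pose m0 : matching n := @Matching n finset.setT (out_pi w) (in2W (@perm_inj _ (out_pi w))).
have core0 : kcore_matching k (out_G1 w) (out_G2 w) m0.
  move=> i _; rewrite leqNgt; apply: contra (low i); apply: leq_ltn_trans.
  rewrite /agree_deg /inter_deg; apply/eq_leq/eq_card => j.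
  by rewrite !inE /inter_edge /= edge_relabel !perm1.
have domT : mdom m = finset.setT.
  apply/eqP; rewrite eqEcard finset.subsetT /=; exact: maxi core0.
have minj : injective (mmap m).
  by move=> i j; apply: (mmap_inj (m := m)); rewrite domT inE.
have sinj : injective (fun i => (out_pi w)^-1%g (mmap m i)).
  by move=> i j /perm_inj /minj.
pose sigma := perm sinj.
have sigmaE i : sigma i = (out_pi w)^-1%g (mmap m i) by rewrite permE.
have sigma1 : sigma = 1%g.
  apply/eqP; have := mis sigma; rewrite negb_and negbK => /orP[//|/forallPn[i]].
  rewrite -ltnNge => /leq_trans /(_ (core i _)); rewrite domT inE => /(_ isT).
  rewrite (_ : agree_deg _ _ _ _ = inter_deg (out_G1 w) (out_G2 w) m i) ?ltnn //.
  rewrite /agree_deg /inter_deg; apply: eq_card => j.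
  by rewrite !inE domT inE /inter_edge /= !sigmaE /out_G2 /edge /= ffunE.
rewrite /matching_is_perm domT eqxx /=; apply/forallP => i.
by have /(congr1 (out_pi w)) := sigmaE i; rewrite sigma1 perm1 permKV => <-.
Qed.

Lemma min_nbhd_le (R : realType) n d (x : 'I_n -> 'rV[R]_d) (r : R) (i : 'I_n) :
  (min_nbhd x r <= #|[set j : 'I_n | (enorm (x i - x j) <= r)%R]%SET|)%N.
Proof. by rewrite /min_nbhd -leEnat; exact: bigmin_le. Qed.

(** With [y = e (n p^2)^c], the pattern count ['C(j n, c j) p^(2 c j)] is at most
    [y ^+ j], and the union bound over relabellings becomes a geometric series of
    ratio [n y]. *)
Lemma failure_expect (R : realType) (n d k c : nat) (x : 'I_n -> 'rV[R]_d) (r p s t : R) :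
  0 <= p <= 1 -> 0 <= s <= 1 -> 0 < t <= 1 -> (6 * c + 1 <= k)%N -> (0 < n)%N ->
  2 * (n%:R * (expR 1 * (n%:R * p ^+ 2) ^+ c)) <= 1 ->
  graphs_expect x r p s (fun H1 H2 => (failure k H1 H2)%:R) <=
  n%:R * (t ^- k * expR (- ((1 - t) * (p * s ^+ 2) * ((min_nbhd x r)%:R - 1)))) +
  2 * (n%:R * (expR 1 * (n%:R * p ^+ 2) ^+ c)).
Proof.
move=> hp hs ht ck n0 small; have /andP[p0 p1] := hp; have /andP[s0 s1] := hs.
have /andP[t0 t1] := ht.
apply: (@le_trans _ _ (graphs_expect x r p s (fun H1 H2 =>
   \sum_i (agree_deg 1%g H1 H2 i < k)%N%:R +
   [exists sigma : 'S_n, (sigma != 1%g) && [forall i, k <= agree_deg sigma H1 H2 i]%N]%:R))).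
  apply: le_graphs_expect => // H1 H2; rewrite /failure.
  case: existsP => [[i lowi]|_] /=; last by rewrite lerDr sumr_ge0 // => ? _; rewrite ler0n.
  rewrite (bigD1 i) //= lowi -addrA lerDl addr_ge0 ?ler0n // sumr_ge0 //.
rewrite graphs_expectD graphs_expect_sum; apply: lerD.
  rewrite -[X in X%:R * _](card_ord n) mulr_natl -sumr_const; apply: ler_sum => i _.
  apply: le_trans (low_degree_expect x r hp hs k i ht) _.
  rewrite ler_wpM2l ?invr_ge0 ?exprn_ge0 ?(ltW t0) // ler_expR lerN2 ler_wpM2l //.
    by rewrite mulr_ge0 ?subr_ge0 // mulr_ge0 ?sqr_ge0.
  by rewrite lerD2r ler_nat min_nbhd_le.
apply: le_trans (misaligned_expect x r hp hs ck) _.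
set y := expR 1 * _; have y0 : 0 <= y.
  by rewrite mulr_ge0 ?expR_ge0 // exprn_ge0 // mulr_ge0 ?ler0n ?sqr_ge0.
apply: le_trans (geometric_le n _ small); last by rewrite mulr_ge0.
apply: le_trans (sum_perm_moved n y0); apply: ler_sum => sigma _.
set j := #|moved sigma|.
apply: (@le_trans _ _ (n%:R ^+ (c * j) * expR 1 ^+ j * p ^+ (2 * (c * j)))).
  by rewrite ler_wpM2r ?exprn_ge0 // bin_le_expR.
by rewrite /y exprMn -exprM exprMn -exprM mulrAC [_ * expR 1 ^+ j]mulrC.
Qed.

(** * Asymptotic rates *)

(** Negative powers of [n] are written [expR (- (a * ln n))] throughout the
    asymptotic estimates. *)
Lemma cvg_expR_ln0 (R : realType) (a : R) : 0 < a ->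
  (fun n : nat => expR (- (a * ln (n%:R : R)))) @ \oo --> (0 : R).
Proof.
move=> a0; apply/cvgrPdist_le => eta eta0; near=> n.
rewrite sub0r normrN ger0_norm ?expR_ge0 // -[leRHS](lnK (x := eta)) ?posrE // ler_expR.
rewrite lerNl -ler_pdivrMl //.
have nbig : expR (a^-1 * - ln eta) <= n%:R by near: n; exact: nbhs_infty_ger.
rewrite -[leLHS]expRK ler_ln ?posrE ?expR_gt0 //.
exact: lt_le_trans (expR_gt0 _) nbig.
Unshelve. all: by end_near.
Qed.

(** The value of [t] is chosen so that [(1 - t) (1 + eps) = 1 + eps / 2]: the
    exponential then beats the factor [n] of the union bound over vertices, with
    [n ^ (- eps / 2)] to spare. *)
Lemma degree_rate (R : realType) (eps q N t : R) (n : nat) : (0 < n)%N -> 0 < eps ->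
  0 <= q <= 1 -> t = eps / 2 / (1 + eps) -> (1 + eps) * ln (n%:R : R) <= q * N ->
  n%:R * expR (- ((1 - t) * q * (N - 1))) <= expR 1 * expR (- (eps / 2 * ln (n%:R : R))).
Proof.
move=> n0 e0 /andP[q0 q1] tE hN; have n0' : 0 < n%:R :> R by rewrite ltr0n.
have t1E : (1 - t) * (1 + eps) = 1 + eps / 2 by rewrite tE; field; lra.
have t0 : 0 <= t by rewrite tE !divr_ge0 //; lra.
have t1 : 0 <= 1 - t.
  by rewrite -(pmulr_lge0 _ (_ : 0 < 1 + eps)) ?t1E; lra.
rewrite -[X in X * _ <= _](lnK (x := n%:R)) ?posrE // -!expRD ler_expR.
have := ler_wpM2l t1 hN; rewrite mulrA t1E.
have : (1 - t) * q <= 1 by rewrite mulr_ile1 //; lra.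
set L := ln _; lra.
Qed.

(** Up to the error term [e], the left-hand side is [n ^ (1 - c (2 alpha - 1))];
    the error is allowed to consume half of the exponent. *)
Lemma pattern_rate (R : realType) (alpha e p : R) (c n : nat) : (0 < n)%N -> 0 <= p ->
  p <= n%:R `^ (- alpha + e) ->
  4 * c%:R * e <= c%:R * (2 * alpha - 1) - 1 ->
  n%:R * (expR 1 * (n%:R * p ^+ 2) ^+ c) <=
  expR 1 * expR (- ((c%:R * (2 * alpha - 1) - 1) / 2 * ln (n%:R : R))).
Proof.
move=> n0 p0 hp he; have n0' : 0 < n%:R :> R by rewrite ltr0n.
rewrite mulrCA ler_wpM2l ?expR_ge0 //.
have L0 : 0 <= ln (n%:R : R) by rewrite ln_ge0 // ler1n.
apply: (@le_trans _ _ (n%:R * (n%:R * (n%:R `^ (- alpha + e)) ^+ 2) ^+ c)).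
  rewrite ler_wpM2l ?ler0n // lerXn2r ?nnegrE ?mulr_ge0 ?ler0n ?sqr_ge0 //.
  by rewrite ler_wpM2l ?ler0n // lerXn2r ?nnegrE ?powR_ge0.
rewrite /powR gt_eqF // -[X in X * (X * _) ^+ _ <= _](lnK (x := n%:R)) ?posrE //.
set L := ln _ in L0 *.
rewrite -expRM_natr -expRD -expRM_natr -expRD ler_expR.
have := ler_wpM2r L0 he; lra.
Qed.

(** * Exact recovery *)

Theorem corollary3 (R : realType)
  (d : nat -> nat) (x : forall n : nat, 'I_n -> 'rV[R]_(d n))
  (r p s : nat -> R) (alpha eps : R) (k : nat)
  (est : forall n : nat, sgraph n -> sgraph n -> matching n)
  (hd : forall n, (0 < d n)%N)
  (hx : forall n (i : 'I_n), usphere (x n i))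
  (hr : forall n, 0 <= r n <= 2)
  (hp : forall n, 0 <= p n <= 1)
  (hs : forall n, 0 <= s n <= 1)
  (halpha : 1 / 2 < alpha <= 1)
  (hp_alpha : exists e : nat -> R, e @ \oo --> (0 : R) /\
     \forall n \near \oo, p n <= n%:R `^ (- alpha + e n))
  (hk0 : (0 < k)%N)
  (hk : 12 / (2 * alpha - 1) < k%:R)
  (heps : 0 < eps)
  (hdeg : \forall n \near \oo,
     (1 + eps) * ln (n%:R : R) <= p n * s n ^+ 2 * (min_nbhd (x n) (r n))%:R)
  (hest : forall n, kcore_estimator k (est n)) :
  (fun n => crgg_prob (x n) (r n) (p n) (s n)
     (fun w : outcome n =>
        matching_is_perm (est n (out_G1 w) (out_G2 w)) (out_pi w)))
    @ \oo --> (1 : R).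
Proof.
have [e [e0 pe]] := hp_alpha; have /andP[alo ahi] := halpha.
(* [6 * c] is the largest multiple of 6 below [k]. Since [6 * c >= k - 6] and
   [2 * alpha - 1 <= 1], the hypothesis on [k] gives
   [c * (2 * alpha - 1) > (12 - 6) / 6 = 1]. *)
pose c := ((k - 1) %/ 6)%N; have ck : (6 * c + 1 <= k)%N by rewrite /c; lia.
have a0 : 0 < 2 * alpha - 1 by lra.
have ca : 1 < c%:R * (2 * alpha - 1).
  have kc : k%:R <= 6 * c%:R + 6 :> R.
    have : (k <= 6 * c + 6)%N by rewrite /c; lia.
    by rewrite -(ler_nat R) natrD natrM.
  move: hk; rewrite ltr_pdivrMr // => hk'.
  have := ler_wpM2r (ltW a0) kc; lra.
pose delta := c%:R * (2 * alpha - 1) - 1; have delta0 : 0 < delta by rewrite /delta; lra.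
pose t := eps / 2 / (1 + eps).
have t01 : 0 < t <= 1.
  rewrite /t !divr_gt0 //=; last by lra.
  by rewrite ler_pdivrMr; lra.
pose E1 n := expR (- (eps / 2 * ln (n%:R : R))).
pose E2 n := expR (- (delta / 2 * ln (n%:R : R))).
have E1c : E1 @ \oo --> (0 : R) by apply: cvg_expR_ln0; rewrite divr_gt0.
have E2c : E2 @ \oo --> (0 : R) by apply: cvg_expR_ln0; rewrite divr_gt0.
pose U n := t ^- k * expR 1 * E1 n + 2 * expR 1 * E2 n.
have Uc : (fun n => 1 - U n) @ \oo --> (1 : R).
  rewrite -[X in _ --> X](subr0 (1 : R)); apply: cvgB; first exact: cvg_cst.
  rewrite -[X in _ --> X](addr0 (0 : R)); apply: cvgD.
    rewrite -[X in _ --> X](mulr0 (t ^- k * expR 1)); apply: cvgM => //; exact: cvg_cst.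
  rewrite -[X in _ --> X](mulr0 (2 * expR 1 : R)); apply: cvgM => //; exact: cvg_cst.
apply: (squeeze_cvgr _ Uc (cvg_cst _)).
have E2small : \forall n \near \oo, E2 n <= (2 * expR 1)^-1.
  have w0 : 0 < (2 * expR 1 : R)^-1 by rewrite invr_gt0 mulr_gt0 ?expR_gt0.
  exact: (cvgr_le _ E2c).
have c0 : 0 < c%:R :> R.
  by rewrite ltr0n lt0n; apply: contraTneq ca => ->; rewrite mul0r -leNgt ler01.
have esmall : \forall n \near \oo, e n <= delta / (4 * c%:R).
  have w0 : 0 < delta / (4 * c%:R) by rewrite divr_gt0 // mulr_gt0.
  exact: (cvgr_le _ e0).
near=> n.
have n0 : (0 < n)%N by near: n; exact: nbhs_infty_gt.
have rate2 : n%:R * (expR 1 * (n%:R * p n ^+ 2) ^+ c) <= expR 1 * E2 n.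
  apply: (pattern_rate n0 (e := e n)); first by case/andP: (hp n).
    by near: n.
  have : e n <= delta / (4 * c%:R) by near: n.
  by rewrite ler_pdivlMr ?mulr_gt0 // mulrC.
have small : 2 * (n%:R * (expR 1 * (n%:R * p n ^+ 2) ^+ c)) <= 1.
  apply: (@le_trans _ _ (2 * (expR 1 * E2 n))); first by rewrite ler_wpM2l.
  have : E2 n <= (2 * expR 1)^-1 by near: n.
  by rewrite -[(2 * _)^-1]mul1r ler_pdivlMr ?mulr_gt0 ?expR_gt0 // mulrC mulrA.
have q01 : 0 <= p n * s n ^+ 2 <= 1.
  have /andP[p0 p1] := hp n; have /andP[s0 s1] := hs n.
  by rewrite mulr_ge0 ?sqr_ge0 //= mulr_ile1 ?sqr_ge0 ?exprn_ile1.
have rate1 : n%:R * expR (- ((1 - t) * (p n * s n ^+ 2) *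
    ((min_nbhd (x n) (r n))%:R - 1))) <= expR 1 * E1 n.
  by apply: degree_rate => //; near: n.
have fail := failure_expect (x n) (r n) (hp n) (hs n) t01 ck n0 small.
have /andP[lo hi] := crgg_prob_bounds (x n) (r n) (hp n) (hs n)
  (fun w => estimator_correct (w := w) (hest n)).
apply/andP; split; last exact: hi.
apply: le_trans lo; rewrite lerD2l lerN2 (le_trans fail) // /U lerD //.
  rewrite mulrCA -[leRHS]mulrA ler_wpM2l // invr_ge0 exprn_ge0 //; by case/andP: t01 => /ltW.
by rewrite -[leRHS]mulrA ler_wpM2l.
Unshelve. all: by end_near.
Qed.
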